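(* Let $L$ be a Moufang loop, let $x\in L$, and let $A,B\subseteq L$ be finite nonempty subsets. Then $|(xA)B|=|A(Bx^{-1})|$ and $|A(Bx)|=|(x^{-1}A)B|$.
   Context: A loop is a set with a binary operation having a two-sided identity $1$ such that for all $a,b$ the equations $ax=b$ and $ya=b$ have unique solutions. A Moufang loop is a loop satisfying $(xy)(zx)=(x(yz))x$ for all $x,y,z$; every element $x$ of it has a unique two-sided inverse $x^{-1}$. For subsets $X,Y$ of a loop, $XY=\{xy:x\in X,y\in Y\}$; $xA=\{xa:a\in A\}$ and $Bx=\{bx:b\in B\}$. *)

(* Defs.v *)
From HB Require Import structures.
From mathcomp Require Import all_boot monoid.
From mathcomp Require Import boolp classical_sets functions cardinality.

Set Implicit Arguments.
Unset Strict Implicit.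
Unset Printing Implicit Defensive.

Local Open Scope group_scope.

(* Built on baseUMagmaType rather than umagmaType, because the latter requires
   a choiceType carrier. *)
HB.mixin Record BaseUMagma_isLoop L of BaseUMagma L := {
  loop_mul1g : forall a : L, 1 * a = a;
  loop_mulg1 : forall a : L, a * 1 = a;
  loop_solvel : forall a b : L, exists! x : L, a * x = b;
  loop_solver : forall a b : L, exists! y : L, y * a = b
}.

#[short(type="loopType")]
HB.structure Definition Loop := {L of BaseUMagma_isLoop L & BaseUMagma L}.

Bind Scope group_scope with Loop.sort.

HB.mixin Record Loop_isMoufang L of Loop L := {
  moufangE : forall x y z : L, (x * y) * (z * x) = (x * (y * z)) * x
}.

#[short(type="moufangLoopType")]
HB.structure Definition MoufangLoop := {L of Loop_isMoufang L & Loop L}.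

Bind Scope group_scope with MoufangLoop.sort.

Lemma moufang_inv_subproof (L : moufangLoopType) (x : L) :
  exists! y : L, x * y = 1 /\ y * x = 1.
Proof.
have [y [xy1 y_uniq]] := loop_solvel x 1.
exists y; split; last by move=> z [xz1 _]; exact: y_uniq.
split=> //.
have xyxx : (x * (y * x)) * x = x * x.
  by rewrite -moufangE xy1 loop_mul1g.
have xyx : x * (y * x) = x.
  have [w [_ w_uniq]] := loop_solver x (x * x).
  by rewrite -(w_uniq _ xyxx) (w_uniq x).
have [w [_ w_uniq]] := loop_solvel x x.
by rewrite -(w_uniq _ xyx) (w_uniq 1) ?loop_mulg1.
Qed.

Definition moufang_inv (L : moufangLoopType) (x : L) : L :=
  sval (cid (moufang_inv_subproof x)).

Lemma moufang_mulgV (L : moufangLoopType) (x : L) : x * moufang_inv x = 1.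
Proof. by rewrite /moufang_inv; case: cid => y [[]]. Qed.

Lemma moufang_mulVg (L : moufangLoopType) (x : L) : moufang_inv x * x = 1.
Proof. by rewrite /moufang_inv; case: cid => y [[]]. Qed.

Local Open Scope classical_set_scope.

Definition set_mul (L : magmaType) (X Y : set L) : set L :=
  [set x * y | x in X & y in Y].

Definition set_lmul (L : magmaType) (x : L) (A : set L) : set L :=
  [set x * a | a in A].

Definition set_rmul (L : magmaType) (B : set L) (x : L) : set L :=
  [set b * x | b in B].

(* Main.v *)
Require Import Defs.
From mathcomp Require Import all_boot monoid.
From mathcomp Require Import boolp classical_sets functions cardinality.

(** Since [b = (b x^-1) x] and [a = x (x^-1 a)], the Moufang identity
    [(x a)(c x) = (x (a c)) x] shows that [(x A) B] and [A (B x)] are the images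
    of [A (B x^-1)] and [(x^-1 A) B] under the injection [p |-> (x p) x]. *)

Local Open Scope group_scope.

Lemma loop_mulgI (L : loopType) (a : L) : injective ( *%g a).
Proof.
move=> b c eq_bc; have [d [_ d_uniq]] := loop_solvel a (a * c).
by rewrite -(d_uniq b) // -(d_uniq c).
Qed.

Lemma loop_mulIg (L : loopType) (a : L) : injective ( *%g^~ a).
Proof.
move=> b c /= eq_bc; have [d [_ d_uniq]] := loop_solver a (c * a).
by rewrite -(d_uniq b) // -(d_uniq c).
Qed.

(** This is the Moufang identity with one inner factor set to [1]; it supplies the rebracketing used
    for right cancellation of inverses. *)
Lemma moufang_flexible (L : moufangLoopType) (x y : L) :
  (x * y) * x = x * (y * x).
Proof. by have := moufangE x 1 y; rewrite loop_mulg1 loop_mul1g => ->. Qed.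

Lemma moufang_mulVKg (L : moufangLoopType) (x a : L) :
  x * (moufang_inv x * a) = a.
Proof.
(* An extra factor [x] on the right makes the Moufang identity applicable:
   [(x (x^-1 a)) x = (x x^-1)(a x) = a x]. *)
apply: (@loop_mulIg _ x).
by rewrite /= -moufangE moufang_mulgV loop_mul1g.
Qed.

Lemma moufang_mulgVK (L : moufangLoopType) (x b : L) :
  (b * moufang_inv x) * x = b.
Proof.
(* Dually, with [x] on the left, flexibility first gives [x ((b x^-1) x) = (x (b x^-1)) x], which is
   [(x b)(x^-1 x) = x b]. *)
apply: (@loop_mulgI _ x).
by rewrite -moufang_flexible -moufangE moufang_mulVg loop_mulg1.
Qed.

Local Open Scope classical_set_scope.
Local Open Scope card_scope.

Lemma set_mul_moufang (L : moufangLoopType) (x : L) (A B : set L) :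
  set_mul (set_lmul x A) (set_rmul B x) #= set_mul A B.
Proof.
have -> : set_mul (set_lmul x A) (set_rmul B x) =
          (fun p : L => (x * p) * x)%g @` set_mul A B.
  apply/seteqP; split=> [_ [_ [a Aa <-] [_ [b Bb <-] <-]]|_ [_ [a Aa [b Bb <-]] <-]].
    by exists (a * b)%g; [exists a => //; exists b | rewrite moufangE].
  rewrite -moufangE; exists (x * a)%g; first by exists a.
  by exists (b * x)%g => //; exists b.
(* The map is a left translation followed by a right one, both injective. *)
by apply: inj_card_eq => p q _ _ /loop_mulIg /loop_mulgI.
Qed.

Lemma set_lmulVK (L : moufangLoopType) (x : L) (A : set L) :
  set_lmul x (set_lmul (moufang_inv x) A) = A.
Proof.
rewrite /set_lmul image_comp -[RHS]image_id; apply: eq_imagel => a _ /=.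
exact: moufang_mulVKg.
Qed.

Lemma set_rmulVK (L : moufangLoopType) (x : L) (B : set L) :
  set_rmul (set_rmul B (moufang_inv x)) x = B.
Proof.
rewrite /set_rmul image_comp -[RHS]image_id; apply: eq_imagel => b _ /=.
exact: moufang_mulgVK.
Qed.

Theorem proposition3p7 (L : moufangLoopType) (x : L) (A B : set L)
    (finA : finite_set A) (finB : finite_set B)
    (A0 : A !=set0) (B0 : B !=set0) :
  (set_mul (set_lmul x A) B #= set_mul A (set_rmul B (moufang_inv x))) /\
  (set_mul A (set_rmul B x) #= set_mul (set_lmul (moufang_inv x) A) B).
Proof.
split.
(* Only the [B] on the left is expanded, to [(B x^-1) x]; the lemma then applies to [A] and
   [B x^-1]. *)
- by rewrite -{1}(set_rmulVK _ x B); exact: set_mul_moufang.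
(* Here the left-hand [A] becomes [x (x^-1 A)], and the lemma applies to [x^-1 A] and [B]. *)
- by rewrite -{1}(set_lmulVK _ x A); exact: set_mul_moufang.
Qed.
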